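(* Let $G$ be an $r$-regular ($r\geq2$) bipartite connected graph of order $n$ with $m$ edges, and let $V_1\cup V_2$ be the bipartition of its vertex set. Let $r=\lambda_0>\lambda_1>\cdots>\lambda_d=-r$ be all distinct eigenvalues of the adjacency matrix $A(G)$ with multiplicities $a_0,\ldots,a_d$, and let $x_1^{(i)},\ldots,x_{a_i}^{(i)}$ be unit orthogonal eigenvectors for $\lambda_i$, $i\in[d]\cup\{0\}$. Let $R_G$ be the $n\times m$ vertex-edge incidence matrix of $G$ and let $\zeta_1,\ldots,\zeta_{m-n+1}$ be all unit orthogonal vectors with $R_G\zeta_k=0$. Then $-2$, $0$ and $$\lambda_{i\pm}=\frac{r+\lambda_i-2\pm\sqrt{(\lambda_i+r)^2+4}}{2}$$ are the eigenvalues of the $\mathcal{Q}$-graph $\mathcal{Q}(G)$, with corresponding eigenvectors $Y_k=\frac{1}{\|\zeta_k\|}\begin{pmatrix}0\\ \zeta_k\end{pmatrix}$ for $k\in[m-n+1]$ (eigenvalue $-2$), $\frac{1}{\sqrt n}\begin{pmatrix}j_{n/2}\\ -j_{n/2}\\ 0_m\end{pmatrix}$ (eigenvalue $0$), and $$X_{i\pm}^j=\frac{1}{\sqrt{(\lambda_{i\pm}+2-r-\lambda_i)^2+\lambda_i+r}}\begin{pmatrix}(\lambda_{i\pm}+2-r-\lambda_i)x_j^{(i)}\\ R_G^Tx_j^{(i)}\end{pmatrix}$$ for $j\in[a_i]$, $i\in[d-1]\cup\{0\}$ (eigenvalue $\lambda_{i\pm}$).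
   Context: $\mathcal{Q}(G)$ is obtained from $G$ by inserting a new vertex on each edge of $G$ and joining two new vertices by an edge whenever the corresponding edges of $G$ are adjacent; its adjacency matrix is $\begin{pmatrix}O & R_G\\ R_G^T & R_G^TR_G-2I_m\end{pmatrix}$ with the vertices of $G$ listed first (those of $V_1$ before those of $V_2$). $j_k$ is the all-one column vector of order $k$, $0_m$ the zero vector of order $m$, $[n]=\{1,\ldots,n\}$. For bipartite $G$ the null space of $R_G$ has dimension $m-n+1$. *)

(* Defs.v *)
From HB Require Import structures.
From mathcomp Require Import all_boot all_order all_algebra.

Set Implicit Arguments.
Unset Strict Implicit.
Unset Printing Implicit Defensive.

Import Order.TTheory GRing.Theory Num.Theory.

Local Open Scope ring_scope.

(** ** Simple graphs on the vertex set ['I_n] *)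

Definition simple_graph n (e : rel 'I_n) : Prop :=
  symmetric e /\ irreflexive e.

Definition regular n (e : rel 'I_n) (r : nat) : Prop :=
  forall u, #|[set v | e u v]| = r.

Definition connected_graph n (e : rel 'I_n) : Prop :=
  (0 < n)%N /\ forall u v, connect e u v.

Definition bipartition n (e : rel 'I_n) (V1 V2 : {set 'I_n}) : Prop :=
  [/\ V1 :&: V2 = set0, V1 :|: V2 = setT &
      forall u v, e u v ->
        (u \in V1) && (v \in V2) || (u \in V2) && (v \in V1)].

Definition edge_set n (e : rel 'I_n) : {set {set 'I_n}} :=
  [set [set p.1; p.2] | p : 'I_n * 'I_n & e p.1 p.2].

(* [ed 0, ..., ed (m - 1)] lists every edge exactly once, in any order. *)
Definition edge_labelling n m (e : rel 'I_n) (ed : 'I_m -> {set 'I_n}) : Prop :=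
  injective ed /\ [set ed k | k : 'I_m] = edge_set e.

(* The original edges of G do not survive: they have been subdivided. *)
Definition Qgraph n m (ed : 'I_m -> {set 'I_n}) : rel ('I_n + 'I_m) :=
  fun p q => match p, q with
  | inl _, inl _ => false
  | inl v, inr k => v \in ed k
  | inr k, inl v => v \in ed k
  | inr k, inr l => (k != l) && (ed k :&: ed l != set0)
  end.

(** ** Matrices *)

Section Matrices.
Variable R : rcfType.

Definition adjmx n (e : rel 'I_n) : 'M[R]_n := \matrix_(i, j) (e i j)%:R.

Definition incmx n m (ed : 'I_m -> {set 'I_n}) : 'M[R]_(n, m) :=
  \matrix_(v, k) (v \in ed k)%:R.

(* [split] lists the vertices of G first, then the inserted ones. *)
Definition Qadjmx n m (ed : 'I_m -> {set 'I_n}) : 'M[R]_(n + m) :=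
  adjmx (fun p q => Qgraph ed (split p) (split q)).

Lemma Qadjmx_block n m (e : rel 'I_n) (ed : 'I_m -> {set 'I_n}) :
  simple_graph e -> edge_labelling e ed ->
  Qadjmx ed = block_mx 0 (incmx ed)
                (incmx ed)^T ((incmx ed)^T *m incmx ed - 2%:M).
Proof.
move=> [_ irr_e] [ed_inj edE].
have ed2 k : #|ed k| = 2%N.
  have : ed k \in edge_set e by rewrite -edE imset_f.
  case/imsetP=> -[u v]; rewrite inE /= => euv ->; rewrite cards2.
  by case: eqP euv => // ->; rewrite irr_e.
have RTR k l : ((incmx ed)^T *m incmx ed) k l = #|ed k :&: ed l|%:R.
  rewrite mxE -sum1_card natr_sum [RHS]big_mkcond /=.
  apply: eq_bigr => v _; rewrite !mxE inE -natrM mulnb.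
  by case: (_ && _).
have sl u : split (lshift m u : 'I_(n + m)) = inl u := unsplitK (inl u).
have sr k : split (rshift n k : 'I_(n + m)) = inr k := unsplitK (inr k).
apply/matrixP=> p q.
case: (split_ordP p) => [u|k] ->; case: (split_ordP q) => [v|l] ->.
- by rewrite block_mxEul !mxE !sl.
- by rewrite block_mxEur !mxE sl sr.
- by rewrite block_mxEdl !mxE sl sr.
rewrite block_mxEdr [LHS]mxE !sr mxE RTR !mxE /=.
have [<-|nkl] := eqVneq k l; first by rewrite setIid ed2 mulr1n subrr.
rewrite mulr0n subr0 /= -card_gt0.
have lt2 : (#|ed k :&: ed l| < 2)%N.
  rewrite ltnNge; apply: contra nkl => le2; apply/eqP/ed_inj.
  have Ik : ed k :&: ed l = ed k by apply/eqP; rewrite eqEcard subsetIl ed2.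
  have Il : ed k :&: ed l = ed l by apply/eqP; rewrite eqEcard subsetIr ed2.
  by rewrite -Ik.
by case: #|_| lt2 => [|[|]].
Qed.

Definition dotcv n (u v : 'cV[R]_n) : R := \sum_i u i 0 * v i 0.

Definition normcv n (u : 'cV[R]_n) : R := Num.sqrt (dotcv u u).

Definition orthonormal_family k n (v : 'I_k -> 'cV[R]_n) : Prop :=
  forall i j, dotcv (v i) (v j) = (i == j)%:R.

(* MathComp's [eigenspace] consists of row vectors; these are column vectors.
   For the symmetric matrices used here the two notions are transposes. *)
Definition eigenvector n (A : 'M[R]_n) (mu : R) (v : 'cV[R]_n) : Prop :=
  v != 0 /\ A *m v = mu *: v.

(** ** Eigenvalues and eigenvectors of the Q-graph *)

(* [s = false] is the sign +, [s = true] the sign -. *)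
Definition Qeig (r : nat) (theta : R) (s : bool) : R :=
  (r%:R + theta - 2 + (-1) ^+ s * Num.sqrt ((theta + r%:R) ^+ 2 + 4)) / 2.

Definition vecY n m (zeta : 'cV[R]_m) : 'cV[R]_(n + m) :=
  (normcv zeta)^-1 *: col_mx 0 zeta.

(* [n] is even for a regular bipartite graph of positive degree, so [n./2] is
   exactly n/2. *)
Definition vecZ n m : 'cV[R]_(n + m) :=
  (Num.sqrt n%:R)^-1 *:
    col_mx (\col_(i < n) (if (i < n./2)%N then 1 else -1)) 0.

Definition vecX n m (ed : 'I_m -> {set 'I_n}) (r : nat) (theta : R) (s : bool)
    (x : 'cV[R]_n) : 'cV[R]_(n + m) :=
  let c := Qeig r theta s + 2 - r%:R - theta in
  (Num.sqrt (c ^+ 2 + theta + r%:R))^-1 *: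
    col_mx (c *: x) ((incmx ed)^T *m x).

End Matrices.

(* Main.v *)
(** With [B] the incidence matrix, [B B^T = A + r], so for [A x = theta x] the
    vectors [(c x, B^T x)] span a [Q]-invariant plane (if [theta <> -r]) on
    which the eigenvalue equation becomes [mu c = theta + r] with
    [c = mu + 2 - r - theta].  At [theta = -r] we get [B^T x = 0], that is,
    [x] changes sign along every edge, so by connectedness the eigenvalue [-r]
    is simple.  All the vectors listed are pairwise orthogonal, and since the
    multiplicities of the symmetric matrix [A] add up to [n] there are at least
    [(m - n + 1) + 1 + 2 (n - 1) = n + m] of them: they form a basis.  Any
    eigenvalue of [Q] has an eigenvector not orthogonal to some basis vector,
    hence is one of the listed ones. *)
Require Import Defs.
From HB Require Import structures.
From mathcomp Require Import all_boot all_order all_algebra.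
From mathcomp Require Import complex ring lra zify.

Set Implicit Arguments.
Unset Strict Implicit.
Unset Printing Implicit Defensive.

Import Order.TTheory GRing.Theory Num.Theory.

Local Open Scope ring_scope.

(** * Dot products, orthogonality and symmetric matrices *)

Section Dot.
Variable R : rcfType.

Lemma dotcvE n (u v : 'cV[R]_n) : dotcv u v = (u^T *m v) 0 0.
Proof. by rewrite !mxE; apply: eq_bigr => i _; rewrite mxE. Qed.

Lemma dotcvC n (u v : 'cV[R]_n) : dotcv u v = dotcv v u.
Proof. by apply: eq_bigr => i _; rewrite mulrC. Qed.

Lemma dotcvDr n (u v w : 'cV[R]_n) : dotcv u (v + w) = dotcv u v + dotcv u w.
Proof. by rewrite !dotcvE mulmxDr mxE. Qed.

Lemma dotcvZr n c (u v : 'cV[R]_n) : dotcv u (c *: v) = c * dotcv u v.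
Proof. by rewrite !dotcvE -scalemxAr mxE. Qed.

Lemma dotcvZl n c (u v : 'cV[R]_n) : dotcv (c *: u) v = c * dotcv u v.
Proof. by rewrite dotcvC dotcvZr dotcvC. Qed.

Lemma dotcv0r n (u : 'cV[R]_n) : dotcv u 0 = 0.
Proof. by rewrite -(scale0r 0) dotcvZr mul0r. Qed.

Lemma dotcv0l n (u : 'cV[R]_n) : dotcv 0 u = 0.
Proof. by rewrite dotcvC dotcv0r. Qed.

Lemma dotcv_trmx n m (M : 'M[R]_(n, m)) u v :
  dotcv (M^T *m u) v = dotcv u (M *m v).
Proof. by rewrite !dotcvE trmx_mul trmxK mulmxA. Qed.

Lemma dotcv_col_mx n m (u u' : 'cV[R]_n) (v v' : 'cV[R]_m) :
  dotcv (col_mx u v) (col_mx u' v') = dotcv u u' + dotcv v v'.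
Proof. by rewrite !dotcvE tr_col_mx mul_row_col mxE. Qed.

Lemma dotcv_eq0 n (u : 'cV[R]_n) : (dotcv u u == 0) = (u == 0).
Proof.
apply/idP/eqP => [|->]; last by rewrite dotcv0r.
rewrite psumr_eq0 => [/allP u0|i _]; last by rewrite -expr2 sqr_ge0.
apply/colP => i; rewrite mxE; apply/eqP.
by have := u0 i (mem_index_enum i); rewrite -expr2 sqrf_eq0.
Qed.

Lemma orthonormal_neq0 k n (v : 'I_k -> 'cV[R]_n) i :
  orthonormal_family v -> v i != 0.
Proof. by move=> ov; rewrite -dotcv_eq0 ov eqxx oner_eq0. Qed.

Lemma dotcv_span_eq0 n (v : 'cV[R]_n) s w :
  {in s, forall b, dotcv v b = 0} -> w \in <<s>>%VS -> dotcv v w = 0.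
Proof.
elim: s w => [|b s IHs] w vs;
  first by rewrite span_nil memv0 => /eqP->; rewrite dotcv0r.
rewrite span_cons => /memv_addP[_ /vlineP[c ->] [w' sw' ->]].
rewrite dotcvDr dotcvZr vs ?mem_head // mulr0 add0r IHs // => b' sb'.
by rewrite vs // inE sb' orbT.
Qed.

(** If the head were in the span of the tail, it would be orthogonal to itself, hence zero. *)
Lemma dotcv_orthogonal_free n (s : seq 'cV[R]_n) :
  0 \notin s -> pairwise (fun u v => dotcv u v == 0) s -> free s.
Proof.
elim: s => [|v s IHs]; first by rewrite nil_free.
rewrite inE negb_or eq_sym free_cons /= => /andP[v0 s0] /andP[vs ps].
rewrite IHs // andbT; apply: contra v0 => /dotcv_span_eq0 sv.
by rewrite -dotcv_eq0 sv // => b sb; apply/eqP/(allP vs).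
Qed.

Lemma eigenvector_eigenvalue n (M : 'M[R]_n) mu v :
  M^T = M -> eigenvector M mu v -> eigenvalue M mu.
Proof.
move=> symM [v0 Mv]; apply/eigenvalueP; exists v^T.
  by rewrite -{1}symM -trmx_mul Mv linearZ.
by apply: contra v0 => /eqP/(congr1 trmx); rewrite trmxK trmx0 => ->.
Qed.

Lemma eigenvalue_eigenvector n (M : 'M[R]_n) mu :
  M^T = M -> eigenvalue M mu -> exists v, eigenvector M mu v.
Proof.
move=> symM /eigenvalueP[v vM v0]; exists v^T; split.
  by apply: contra v0 => /eqP/(congr1 trmx); rewrite trmxK trmx0 => ->.
by rewrite -{1}symM -trmx_mul vM linearZ.
Qed.

(** Symmetry moves [M] from one side of the dot product to the other, so [mu - nu] times the product
    vanishes. *)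
Lemma eigenvector_orthogonal n (M : 'M[R]_n) mu nu u v :
  M^T = M -> M *m u = mu *: u -> M *m v = nu *: v -> mu != nu ->
  dotcv u v = 0.
Proof.
move=> symM Mu Mv neq; apply/eqP.
rewrite -(mulrI_eq0 _ (mulfI (x := mu - nu) _)) ?subr_eq0 //.
by rewrite mulrBl -dotcvZl -Mu -dotcvZr -Mv -{1}symM dotcv_trmx subrr.
Qed.

(** Otherwise an eigenvector for [mu] would be orthogonal to every member of [s], hence to the whole
    space and to itself. *)
Lemma eigenvalue_eigenbasis n (M : 'M[R]_n) (s : seq 'cV[R]_n) mu :
  M^T = M -> basis_of fullv s ->
  {in s, forall b, exists nu, M *m b = nu *: b} ->
  eigenvalue M mu -> exists2 b, b \in s & M *m b = mu *: b.
Proof.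
move=> symM bs eig /eigenvalue_eigenvector[] // v [v0 Mv].
have [/hasP[b sb /eqP]|/hasPn nos] := boolP (has (fun b => M *m b == mu *: b) s).
  by exists b.
case/eqP: v0; apply/eqP; rewrite -dotcv_eq0.
rewrite (@dotcv_span_eq0 _ v s) ?(span_basis bs) ?memvf // => b sb.
have [nu Mb] := eig b sb; apply: (eigenvector_orthogonal symM Mv Mb).
by apply: contra (nos b sb) => /eqP->; rewrite Mb.
Qed.

(** The polynomial splits over the algebraically closed field [R[i]]; the Hermitian argument shows
    that its roots are real, so the factorization descends to [R]. *)
Lemma char_poly_symmetric n (M : 'M[R]_n) :
  M^T = M -> exists s : seq R, char_poly M = \prod_(t <- s) ('X - t%:P).
Proof.
move=> symM; pose f : {rmorphism R -> R[i]} := real_complex R.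
have [s] := closed_field_poly_normal (map_poly f (char_poly M)).
rewrite lead_coef_map (monicP (char_poly_monic M)) rmorph1 scale1r => def_s.
have sR z : z \in s -> z = f (complex.Re z).
  rewrite -root_prod_XsubC -def_s map_char_poly -eigenvalue_root_char.
  case/eigenvalueP=> v vM v0.
  pose w := map_mx Num.conj v.
  have wM : w *m map_mx f M = Num.conj z *: w.
    rewrite -map_mxZ -vM map_mxM; congr (_ *m _).
    by apply/matrixP=> i j; rewrite !mxE; apply/esym/CrealP; rewrite complex_real.
  (* As [w] is the conjugate of [v], this entry is the sum of the squared moduli of the entries of
     [v]. *)
  have vw0 : (v *m w^T) 0 0 != 0.
    apply: contra v0; rewrite mxE psumr_eq0 => [/allP vw0|i _]; last first.
      by rewrite !mxE -normCK exprn_ge0.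
    apply/eqP/rowP=> i; have := vw0 i (mem_index_enum i).
    by rewrite !mxE /= -normCK sqrf_eq0 normr_eq0 => /eqP.
  (* Both sides evaluate [v M w^T], with [M] acting on the left factor or on the right one. *)
  have : z * (v *m w^T) 0 0 = Num.conj z * (v *m w^T) 0 0.
    have mulZ c (A : 'M[R[i]]_1) : c * A 0 0 = (c *: A) 0 0 by rewrite mxE.
    rewrite !mulZ scalemxAl -vM scalemxAr.
    have -> : Num.conj z *: w^T = map_mx f M *m w^T.
      by apply: trmx_inj; rewrite linearZ /= trmx_mul !trmxK map_trmx symM wM.
    by rewrite mulmxA.
  by move/(mulIf vw0)/esym/CrealP/RRe_real/esym.
exists (map (@complex.Re R) s); apply: (map_poly_inj f).
rewrite def_s rmorph_prod /= big_map.
by apply: eq_big_seq => z /sR {1}->; rewrite map_polyXsubC.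
Qed.

(** The characteristic polynomial has [n] linear factors, and each root in that list adds one to the
    multiplicity of exactly one [lam i]. *)
Lemma sum_mup_symmetric n d (M : 'M[R]_n) (lam : 'I_d -> R) :
  M^T = M -> injective lam ->
  (forall t, eigenvalue M t <-> exists i, t = lam i) ->
  (\sum_i mup (lam i) (char_poly M) = n)%N.
Proof.
move=> /char_poly_symmetric[s def_s] lam_inj lam_all.
have sz_s : size s = n by have := size_char_poly M; rewrite def_s size_prod_XsubC => -[].
have sl t : t \in s -> exists i, t = lam i.
  by rewrite -root_prod_XsubC -def_s -eigenvalue_root_char => /lam_all.
rewrite def_s; under eq_bigr do rewrite mu_prod_XsubC.
rewrite -{}sz_s.
elim: s sl {def_s} => [|t s IHs] sl /=; first by rewrite big1.
rewrite big_split /= IHs => [|t' st']; last by apply: sl; rewrite inE st' orbT.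
have [i ->] := sl t (mem_head _ _).
rewrite (bigD1 i) //= eqxx big1 // => j; rewrite eq_sym => /negPf.
by rewrite (inj_eq lam_inj) => ->.
Qed.

End Dot.

(** * Incidence matrix of a regular graph, the eigenvalue [- r], and the bipartition *)

Section Graph.
Variables (R : rcfType) (n m r : nat) (e : rel 'I_n) (ed : 'I_m -> {set 'I_n}).
Hypotheses (e_simple : simple_graph e) (e_regular : regular e r).
Hypothesis ed_edges : edge_labelling e ed.

Lemma edge_neq u v : e u v -> u != v.
Proof. by apply: contraTneq => ->; rewrite e_simple.2. Qed.

Lemma edge_setP (E : {set 'I_n}) :
  reflect (exists u v, e u v /\ E = [set u; v]) (E \in edge_set e).
Proof.
apply: (iffP imsetP) => [[[u v]]|[u [v [euv ->]]]]; first by rewrite inE; exists u, v.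
by exists (u, v); rewrite ?inE.
Qed.

Lemma edge_labelP u v : e u v -> exists k, ed k = [set u; v].
Proof.
move=> euv; have : [set u; v] \in edge_set e by apply/edge_setP; exists u, v.
by rewrite -ed_edges.2 => /imsetP[k _ ->]; exists k.
Qed.

Lemma label_edgeP k : exists u v, e u v /\ ed k = [set u; v].
Proof. by apply/edge_setP; rewrite -ed_edges.2 imset_f. Qed.

(** These counts are the entries of the incidence matrix times its transpose: degrees on the
    diagonal, adjacencies off it. *)
Lemma card_edges_through u v :
  #|[set E in edge_set e | (u \in E) && (v \in E)]| =
  (e u v + (u == v) * r)%N.
Proof.
have [<-|nuv] := eqVneq u v.
  rewrite e_simple.2 mul1n add0n -(e_regular u).
  (* Sending a neighbour [w] to the edge from [u] to [w] is a bijection onto the edges at [u]. *)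
  rewrite -(card_in_imset (f := fun w => [set u; w])).
    apply: eq_card => E; rewrite inE andbb; apply/andP/imsetP => [[]|[w]].
      case/edge_setP=> w [w' [eww ->]]; rewrite !inE => /orP[]/eqP->.
        by exists w'; rewrite ?inE.
      by exists w; rewrite ?inE 1?e_simple.1 // setUC.
    rewrite inE => euw ->; rewrite !inE eqxx; split=> //.
    by apply/edge_setP; exists u, w.
  move=> w w'; rewrite !inE => /edge_neq nuw _ /setP/(_ w).
  by rewrite !inE eqxx orbT eq_sym (negPf nuw) => /esym/eqP.
rewrite mul0n addn0.
have [euv|neuv] := boolP (e u v).
  rewrite /= -(cards1 [set u; v]); apply: eq_card => E; rewrite !inE.
  apply/andP/eqP => [[]|->]; last first.
    by rewrite !inE !eqxx orbT; split=> //; apply/edge_setP; exists u, v.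
  case/edge_setP=> w [w' [_ ->]]; rewrite !inE.
  case/andP=> /orP[]/eqP eu /orP[]/eqP ev; move: nuv; rewrite eu ev ?eqxx // => _.
  by rewrite setUC.
apply/eqP; rewrite cards_eq0; apply/eqP/setP => E; rewrite !inE.
apply/negP=> /andP[/edge_setP[w [w' [eww ->]]]]; rewrite !inE.
case/andP=> /orP[]/eqP eu /orP[]/eqP ev; move: nuv neuv; rewrite eu ev ?eqxx ?eww //.
by rewrite e_simple.1 eww.
Qed.

Lemma incmx_mul_tr : incmx R ed *m (incmx R ed)^T = adjmx R e + r%:R%:M.
Proof.
apply/matrixP=> u v; rewrite !mxE.
transitivity (#|[set E in edge_set e | (u \in E) && (v \in E)]|%:R : R).
  rewrite -ed_edges.2 -sum1_card natr_sum.
  rewrite (eq_bigl (fun E => (E \in [set ed k | k : 'I_m]) &&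
    ((u \in E) && (v \in E)))); last first.
    by move=> E; rewrite inE.
  rewrite big_mkcondr big_imset /=; last by move=> k l _ _; apply: ed_edges.1.
  by apply: eq_bigr => k _; rewrite !mxE -natrM mulnb; case: (_ && _).
by rewrite card_edges_through natrD; case: (u == v); rewrite ?mul1n.
Qed.

Lemma adjmx_tr : (adjmx R e)^T = adjmx R e.
Proof. by apply/matrixP=> i j; rewrite !mxE e_simple.1. Qed.

Lemma Qadjmx_tr : (Qadjmx R ed)^T = Qadjmx R ed.
Proof.
rewrite (Qadjmx_block R e_simple ed_edges) tr_block_mx trmx0 trmxK.
by rewrite linearB /= trmx_mul trmxK tr_scalar_mx.
Qed.

Lemma incmx_trM k u w (v : 'cV[R]_n) : e u w -> ed k = [set u; w] ->
  ((incmx R ed)^T *m v) k 0 = v u 0 + v w 0.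
Proof.
move=> /edge_neq nuw edk; rewrite mxE.
rewrite (eq_bigr (fun i => if i \in [set u; w] then v i 0 else 0)); last first.
  by move=> i _; rewrite !mxE edk; case: ifP; rewrite ?mul1r ?mul0r.
by rewrite -big_mkcond big_setU1 ?big_set1 // inE.
Qed.

Lemma incmx_trM_eq0 (v : 'cV[R]_n) :
  (incmx R ed)^T *m v = 0 <-> forall u w, e u w -> v w 0 = - v u 0.
Proof.
split=> [Rv u w euw|vN].
  have [k edk] := edge_labelP euw; apply/eqP; rewrite -addr_eq0 addrC.
  by rewrite -(incmx_trM v euw edk) Rv mxE.
apply/colP=> k; have [u [w [euw edk]]] := label_edgeP k.
by rewrite (incmx_trM v euw edk) (vN u w) // subrr mxE.
Qed.

(** The value of [v] is negated along each edge, so a zero at [u] propagates along paths to every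
    vertex. *)
Lemma incmx_trM_inj (v : 'cV[R]_n) u :
  connected_graph e -> (incmx R ed)^T *m v = 0 -> v u 0 = 0 -> v = 0.
Proof.
move=> [_ conn] /incmx_trM_eq0 vN vu; apply/colP=> w; rewrite mxE.
have /connectP[p] := conn u w.
elim: p u vu => [|u' p IHp] u vu /=; first by move=> _ ->.
by case/andP=> /vN vu'; apply: IHp; rewrite vu' vu oppr0.
Qed.

Lemma eigenvector_incmx_tr theta (v : 'cV[R]_n) :
  adjmx R e *m v = theta *: v ->
  incmx R ed *m ((incmx R ed)^T *m v) = (theta + r%:R) *: v.
Proof. by move=> Av; rewrite mulmxA incmx_mul_tr mulmxDl Av mul_scalar_mx scalerDl. Qed.

Lemma eigenvector_opp_degree (v : 'cV[R]_n) :
  adjmx R e *m v = - r%:R *: v <-> (incmx R ed)^T *m v = 0.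
Proof.
split=> [/eigenvector_incmx_tr Rv|Rv].
  (* With [B] the incidence matrix, the squared norm of [B^T v] is the dot product of [v] with
     [B B^T v = (- r + r) v = 0]. *)
  by apply/eqP; rewrite -dotcv_eq0 dotcv_trmx Rv addNr scale0r dotcv0r.
have := congr1 (mulmx^~ v) incmx_mul_tr.
rewrite -mulmxA Rv mulmx0 mulmxDl mul_scalar_mx scaleNr => /esym/eqP.
by rewrite addr_eq0 => /eqP.
Qed.

Lemma connected_opp_degree_simple a (x : 'I_a -> 'cV[R]_n) :
  connected_graph e -> orthonormal_family x ->
  (forall j, eigenvector (adjmx R e) (- r%:R) (x j)) -> (a <= 1)%N.
Proof.
move=> conn ox eig; rewrite leqNgt; apply/negP=> a_gt1.
pose i := Ordinal (ltnW a_gt1); pose j := Ordinal a_gt1; pose u := Ordinal conn.1.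
have Rx k : (incmx R ed)^T *m x k = 0 by apply/eigenvector_opp_degree/(eig k).2.
(* This combination is chosen to vanish at [u], so it is zero. Its product with [x i] then gives
   [x j u 0 = 0], which forces the unit vector [x j] to vanish. *)
have xij : x j u 0 *: x i + - x i u 0 *: x j = 0.
  apply: (@incmx_trM_inj _ u) => //.
    by rewrite mulmxDr -!scalemxAr !Rx !scaler0 addr0.
  by rewrite !mxE mulrC mulNr subrr.
have := congr1 (dotcv (x i)) xij.
rewrite dotcv0r dotcvDr !dotcvZr !ox eqxx mulr1 mulr0 addr0 => xj0.
by case/eqP: (orthonormal_neq0 j ox); apply: incmx_trM_inj xj0.
Qed.

(** Counting the edges between the classes from either side gives [r] times the size of that
    side. *)
Lemma bipartition_card_eq (V1 V2 : {set 'I_n}) :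
  (0 < r)%N -> bipartition e V1 V2 -> #|V1| = #|V2|.
Proof.
move=> r_gt0 [V12 _ eV]; apply/eqP; rewrite -(eqn_pmul2r r_gt0) -!sum_nat_const.
have out (W : {set 'I_n}) u : (forall v, e u v -> v \in W) ->
    (\sum_(v in W) e u v)%N = r.
  move=> uW; rewrite -(e_regular u) -sum1_card [RHS]big_mkcond [LHS]big_mkcond.
  apply: eq_bigr => v _; rewrite inE.
  by case euv: (e u v); [rewrite uW | case: ifP].
have nV u : u \in V1 -> u \in V2 -> false.
  by move=> u1 u2; rewrite -(in_set0 u) -V12 inE u1.
apply/eqP; transitivity (\sum_(u in V1) \sum_(v in V2) e u v)%N.
  apply: eq_bigr => u u1; rewrite out // => v /eV /orP[]/andP[] //.
  by move=> /(nV _ u1).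
rewrite exchange_big; apply: eq_bigr => v v2.
rewrite (eq_bigr (fun u => nat_of_bool (e v u))) => [|u _]; last by rewrite e_simple.1.
by apply: out => u /eV /orP[]/andP[] // /nV /(_ v2).
Qed.

(** Identifies the sign vector of [vecZ], which is defined by position, with the one that is 1 on
    [V1] and -1 on [V2]. *)
Lemma bipartition_first_half (V1 V2 : {set 'I_n}) :
  (0 < r)%N -> bipartition e V1 V2 ->
  (forall u v : 'I_n, u \in V1 -> v \in V2 -> (u < v)%N) ->
  forall u : 'I_n, (u \in V1) = (u < n./2)%N.
Proof.
move=> r_gt0 bip V1_first u.
have eqV := bipartition_card_eq r_gt0 bip; case: bip => V12 VT _.
have nV2 v : (v \in V2) = (v \notin V1).
  have := in_setT v; rewrite -VT inE; have := in_set0 v; rewrite -V12 inE.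
  by case: (v \in V1); case: (v \in V2).
have -> : n./2 = #|V1|.
  have : (#|V1| + #|V2|)%N = n by rewrite -cardsUI V12 VT cards0 addn0 cardsT card_ord.
  by rewrite -eqV addnn => {1}<-; rewrite doubleK.
have card_lt k : (k <= n)%N -> #|[set v : 'I_n | (v < k)%N]| = k.
  move=> le_kn; rewrite cardsE -sum1_card (eq_bigl (fun v : 'I_n => (v < k)%N)) //.
  by rewrite (big_ord_narrow le_kn) sum1_card card_ord.
(* If [u] is in [V1], so are all [v <= u], whence [u < #|V1|]. If [u] is in [V2], all of [V1] lies
   strictly below [u], whence [#|V1| <= u]. *)
case: ltnP => [lt_u|le_u]; last first.
  apply/negP=> u1; have : (u < #|V1|)%N; last by rewrite ltnNge le_u.
  rewrite -(card_lt _ (ltn_ord u)); apply: subset_leq_card.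
  apply/subsetP=> v; rewrite inE ltnS => le_vu; rewrite -[_ \in _]negbK -nV2.
  by apply/negP=> /(V1_first _ _ u1); rewrite ltnNge le_vu.
rewrite -[LHS]negbK -nV2; apply/negP=> u2; move: lt_u.
rewrite ltnNge -[X in (_ <= X)%N](card_lt _ (ltnW (ltn_ord u))) => /negP; apply.
by apply/subset_leq_card/subsetP=> v /V1_first/(_ u2); rewrite inE.
Qed.

Lemma halves_incmx_tr (V1 V2 : {set 'I_n}) :
  (0 < r)%N -> bipartition e V1 V2 ->
  (forall u v : 'I_n, u \in V1 -> v \in V2 -> (u < v)%N) ->
  (incmx R ed)^T *m \col_(i < n) (if (i < n./2)%N then 1 else -1) = 0.
Proof.
move=> r_gt0 bip V1_first; apply/incmx_trM_eq0 => u v.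
have half := bipartition_first_half r_gt0 bip V1_first; case: bip => V12 _ eV.
have nV w : w \in V1 -> w \in V2 -> false.
  by move=> w1 w2; rewrite -(in_set0 w) -V12 inE w1.
rewrite !mxE -!half => /eV /orP[]/andP[].
  by move=> -> v2; case: ifP => // /nV /(_ v2).
by move=> u2 ->; case: ifP => [/nV /(_ u2)//|_]; rewrite opprK.
Qed.

End Graph.

Lemma pairwise_map_uniq (S : eqType) T (rel_T : rel T) (f : S -> T) s :
  uniq s -> {in s &, forall p q, p != q -> rel_T (f p) (f q)} ->
  pairwise rel_T (map f s).
Proof.
move=> us fP; rewrite pairwise_map; move: us; rewrite uniq_pairwise.
by apply: (sub_in_pairwise (P := mem s)) => //; apply/allP.
Qed.

(** * Eigenvectors of the Q-graph and their orthogonality *)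

Section QgraphVectors.
Variables (R : rcfType) (n m r : nat) (e : rel 'I_n) (ed : 'I_m -> {set 'I_n}).
Hypotheses (e_simple : simple_graph e) (e_regular : regular e r).
Hypothesis ed_edges : edge_labelling e ed.
Implicit Types (theta : R) (x : 'cV[R]_n) (s : bool).

Lemma Qadjmx_col_mx (u : 'cV[R]_n) (w : 'cV[R]_m) :
  Qadjmx R ed *m col_mx u w =
  col_mx (incmx R ed *m w)
    ((incmx R ed)^T *m (u + incmx R ed *m w) - 2 *: w).
Proof.
rewrite (Qadjmx_block R e_simple ed_edges) mul_block_col mul0mx add0r.
by rewrite mulmxBl mul_scalar_mx mulmxDr mulmxA addrA.
Qed.

Lemma vecY_eigenvector (zeta : 'cV[R]_m) :
  zeta != 0 -> incmx R ed *m zeta = 0 ->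
  eigenvector (Qadjmx R ed) (-2) (vecY n zeta).
Proof.
move=> z0 Rz; split.
  rewrite scaler_eq0 negb_or invr_eq0 sqrtr_eq0 -ltNge lt_def dotcv_eq0 z0.
  rewrite sumr_ge0 => [|i _]; last by rewrite -expr2 sqr_ge0.
  by rewrite col_mx_eq0 negb_and z0 orbT.
rewrite -scalemxAr Qadjmx_col_mx Rz addr0 mulmx0 sub0r.
rewrite [RHS]scalerA mulrC -[RHS]scalerA; congr (_ *: _).
by rewrite scale_col_mx scaler0 scaleNr.
Qed.

(** The factor of [x] in the upper block of [vecX], before normalization. *)
Let coef theta s := Qeig r theta s + 2 - r%:R - theta.

Let sqr_sqrt_disc theta :
  Num.sqrt ((theta + r%:R) ^+ 2 + 4) ^+ 2 = (theta + r%:R) ^+ 2 + 4.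
Proof. by rewrite sqr_sqrtr // addr_ge0 ?sqr_ge0. Qed.

(* [Qeig r theta s] is a root of [t (t + 2 - r - theta) = theta + r]. *)
Lemma Qeig_coef theta s : Qeig r theta s * coef theta s = theta + r%:R.
Proof.
have := sqr_sqrt_disc theta; rewrite /coef /Qeig.
set S := Num.sqrt _ => S2; case: s; rewrite ?expr0 ?expr1; lra.
Qed.

(** Each factor is minus the eigenvalue of the opposite sign, so this is the product of the two
    roots of the quadratic. It makes the vectors of opposite signs orthogonal. *)
Lemma coef_opp theta : coef theta false * coef theta true = - (theta + r%:R).
Proof.
have := sqr_sqrt_disc theta; rewrite /coef /Qeig expr0 expr1.
set S := Num.sqrt _ => S2; lra.
Qed.

Lemma vecX_eigenvector theta s x :
  0 < theta + r%:R -> eigenvector (adjmx R e) theta x ->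
  eigenvector (Qadjmx R ed) (Qeig r theta s) (vecX ed r theta s x).
Proof.
move=> t_gt0 [x0 /(eigenvector_incmx_tr e_simple e_regular ed_edges) Rx].
have := Qeig_coef theta s; rewrite /vecX -/(coef theta s).
set c := coef theta s => mu_c.
(* Since [c] is nonzero, the upper block [c *: x] already shows that the vector is nonzero. *)
have c0 : c != 0 by apply: contraTneq t_gt0 => c0; rewrite -mu_c c0 mulr0 ltxx.
split.
  rewrite scaler_eq0 negb_or invr_eq0 sqrtr_eq0 -ltNge -addrA.
  rewrite ltr_wpDl ?sqr_ge0 //= col_mx_eq0 negb_and scaler_eq0.
  by rewrite (negPf c0) (negPf x0).
rewrite -scalemxAr Qadjmx_col_mx Rx scalerA mulrC -scalerA -scalerDl -scalemxAr.
(* The upper block is the relation [mu_c]; the lower one asks for [c + (theta + r) - 2] to be the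
   eigenvalue, which is how [c] is defined. *)
rewrite -scalerBl scale_col_mx scalerA mu_c; congr (_ *: col_mx _ (_ *: _)).
by rewrite /c /coef; ring.
Qed.

Lemma dotcv_vecY_vecX (zeta : 'cV[R]_m) theta s x :
  incmx R ed *m zeta = 0 -> dotcv (vecY n zeta) (vecX ed r theta s x) = 0.
Proof.
move=> Rz; rewrite dotcvZl dotcvZr dotcv_col_mx dotcv0l add0r.
by rewrite dotcvC dotcv_trmx Rz dotcv0r !mulr0.
Qed.

(** The lower blocks contribute the product of [x] with [B B^T x'], that is, [theta' + r] times that
    of [x] and [x']. The normalizing factors are hidden in [k], as only vanishing matters later. *)
Lemma dotcv_vecX theta theta' s s' x x' : adjmx R e *m x' = theta' *: x' ->
  exists k, dotcv (vecX ed r theta s x) (vecX ed r theta' s' x') =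
    k * ((coef theta s * coef theta' s' + (theta' + r%:R)) * dotcv x x').
Proof.
move=> /(eigenvector_incmx_tr e_simple e_regular ed_edges) Rx.
rewrite /vecX; set k := (Num.sqrt _)^-1; set k' := (Num.sqrt _)^-1.
exists (k * k'); rewrite dotcvZl dotcvZr dotcv_col_mx dotcv_trmx Rx.
by rewrite !(dotcvZl, dotcvZr) -!/(coef _ _); ring.
Qed.

Lemma vecX_orthogonal theta theta' s s' x x' :
  adjmx R e *m x' = theta' *: x' -> dotcv x x' = 0 ->
  dotcv (vecX ed r theta s x) (vecX ed r theta' s' x') = 0.
Proof. by case/(dotcv_vecX theta s s' x) => k -> ->; rewrite !mulr0. Qed.

Lemma vecX_conjugate_orthogonal theta x x' : adjmx R e *m x' = theta *: x' ->
  dotcv (vecX ed r theta false x) (vecX ed r theta true x') = 0.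
Proof.
by case/(dotcv_vecX theta false true x) => k ->; rewrite coef_opp addNr mul0r mulr0.
Qed.

End QgraphVectors.

(** * Assembling the eigenbasis and reading off the spectrum *)

Theorem theorem3p2 (R : rcfType) (n m r d : nat) (e : rel 'I_n)
  (V1 V2 : {set 'I_n}) (ed : 'I_m -> {set 'I_n})
  (lam : 'I_d.+1 -> R) (a : 'I_d.+1 -> nat)
  (x : forall i : 'I_d.+1, 'I_(a i) -> 'cV[R]_n)
  (zeta : 'I_(m - n + 1) -> 'cV[R]_m)
  (e_simple : simple_graph e)
  (r_ge2 : (2 <= r)%N)
  (e_regular : regular e r)
  (e_connected : connected_graph e)
  (e_bip : bipartition e V1 V2)
  (V1_first : forall u v : 'I_n, u \in V1 -> v \in V2 -> (u < v)%N)
  (ed_edges : edge_labelling e ed)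
  (lam_first : lam ord0 = r%:R)
  (lam_last : lam ord_max = - r%:R)
  (lam_decr : forall i j : 'I_d.+1, (i < j)%N -> lam j < lam i)
  (lam_all : forall t : R, eigenvalue (adjmx R e) t <-> exists i, t = lam i)
  (a_mult : forall i, a i = mup (lam i) (char_poly (adjmx R e)))
  (x_eigen : forall i j, eigenvector (adjmx R e) (lam i) (x i j))
  (x_orthonormal : forall i, orthonormal_family (x i))
  (zeta_ker : forall k, incmx R ed *m zeta k = 0)
  (zeta_orthonormal : orthonormal_family zeta) :
  [/\ forall mu : R, eigenvalue (Qadjmx R ed) mu <->
        [\/ mu = -2, mu = 0 |
            exists (i : 'I_d.+1) (s : bool),
              (i < d)%N /\ mu = Qeig r (lam i) s],
      forall k, eigenvector (Qadjmx R ed) (-2) (vecY n (zeta k)),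
      eigenvector (Qadjmx R ed) 0 (vecZ R n m),
      forall (i : 'I_d.+1) (j : 'I_(a i)) (s : bool), (i < d)%N ->
        eigenvector (Qadjmx R ed) (Qeig r (lam i) s)
          (vecX ed r (lam i) s (x i j)) &
      basis_of fullv
        ([seq vecY n (zeta k) | k <- enum 'I_(m - n + 1)] ++
         vecZ R n m ::
         [seq vecX ed r (lam i) false (x i j) |
           i <- enum [pred i : 'I_d.+1 | (i < d)%N], j <- enum 'I_(a i)] ++
         [seq vecX ed r (lam i) true (x i j) |
           i <- enum [pred i : 'I_d.+1 | (i < d)%N], j <- enum 'I_(a i)])].
Proof.
have r_gt0 : (0 < r)%N by apply: ltnW.
have n_gt0 := e_connected.1.
have A_tr := adjmx_tr R e_simple.
have Q_tr := Qadjmx_tr R e_simple ed_edges.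
have lam_neq i j : i != j -> lam i != lam j.
  rewrite neq_ltn => /orP[]/lam_decr lt_lam.
    by rewrite (gt_eqF lt_lam).
  by rewrite (lt_eqF lt_lam).
have lam_gt (i : 'I_d.+1) : (i < d)%N -> 0 < lam i + r%:R.
  by move=> lt_id; rewrite -[r%:R]opprK -lam_last subr_gt0 lam_decr.
have a_gt0 i : (0 < a i)%N.
  rewrite a_mult -XsubC_dvd ?monic_neq0 ?char_poly_monic // dvdp_XsubCl.
  by rewrite -eigenvalue_root_char; apply/lam_all; exists i.
have a_last : a ord_max = 1%N.
  apply/eqP; rewrite eqn_leq a_gt0 andbT.
  apply: (connected_opp_degree_simple e_simple e_regular ed_edges e_connected
    (x_orthonormal ord_max)).
  by move=> j; rewrite -lam_last.
(* The multiplicities add up to [n]; leaving out the simple eigenvalue [- r], at index [ord_max],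
   gives [n.-1]. *)
have sum_a : (\sum_(i : 'I_d.+1 | (i < d)%N) a i = n.-1)%N.
  have lam_inj : injective lam.
    by move=> i j eq_lam; apply: contraTeq isT => /lam_neq; rewrite eq_lam eqxx.
  have := sum_mup_symmetric A_tr lam_inj lam_all.
  rewrite (bigD1 ord_max) //= -a_mult a_last add1n => <- /=.
  apply: eq_big => i //; rewrite ?a_mult //.
  by rewrite -val_eqE /= ltn_neqAle -ltnS ltn_ord andbT.
have Y_eig k : eigenvector (Qadjmx R ed) (-2) (vecY n (zeta k)).
  apply: (vecY_eigenvector e_simple ed_edges _ (zeta_ker k)).
  exact: orthonormal_neq0.
pose z : 'cV[R]_n := \col_(i < n) (if (i < n./2)%N then 1 else -1).
have Rz : (incmx R ed)^T *m z = 0.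
  exact: (halves_incmx_tr R e_simple e_regular ed_edges r_gt0 e_bip V1_first).
have Z_eig : eigenvector (Qadjmx R ed) 0 (vecZ R n m).
  split.
    rewrite scaler_eq0 negb_or invr_eq0 sqrtr_eq0 -ltNge ltr0n n_gt0.
    rewrite col_mx_eq0 negb_and; apply/orP; left; apply/eqP.
    move/colP/(_ (Ordinal n_gt0))/eqP; rewrite !mxE.
    by case: ifP; rewrite ?oppr_eq0 oner_eq0.
  rewrite scale0r -scalemxAr (Qadjmx_col_mx e_simple ed_edges) mulmx0 addr0.
  by rewrite Rz scaler0 subr0 col_mx0 scaler0.
have X_eig (i : 'I_d.+1) j s : (i < d)%N ->
    eigenvector (Qadjmx R ed) (Qeig r (lam i) s) (vecX ed r (lam i) s (x i j)).
  by move=> /lam_gt lt0; apply: (vecX_eigenvector e_simple e_regular ed_edges).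
(* Dependent pairs turn the double family into a single list of indices, shared by both signs. *)
pose T := [seq Tagged (fun i => 'I_(a i)) j |
  i <- enum [pred i : 'I_d.+1 | (i < d)%N], j <- enum 'I_(a i)].
pose X s (p : {i : 'I_d.+1 & 'I_(a i)}) :=
  vecX ed r (lam (tag p)) s (x (tag p) (tagged p)).
have size_T : size T = n.-1.
  rewrite size_allpairs_dep sumnE big_map big_enum -sum_a.
  by apply: eq_bigr => i _; rewrite -cardE card_ord.
have X_list s : [seq vecX ed r (lam i) s (x i j) |
    i <- enum [pred i : 'I_d.+1 | (i < d)%N], j <- enum 'I_(a i)] = map (X s) T.
  by rewrite map_allpairs.
have T_lt p : p \in T -> (tag p < d)%N.
  by case/allpairsPdep=> i [j [+ _ ->]]; rewrite mem_enum.
have x_orth (p q : {i : 'I_d.+1 & 'I_(a i)}) : p != q ->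
    dotcv (x (tag p) (tagged p)) (x (tag q) (tagged q)) = 0.
  case: p q => [i j] [i' j'] /= npq; have [ii'|nii'] := eqVneq i i'.
    rewrite -{i'}ii' in j' npq *; rewrite x_orthonormal.
    by case: (eqVneq j j') npq => [->|_ _ //]; rewrite eqxx.
  exact: (eigenvector_orthogonal A_tr (x_eigen i j).2 (x_eigen i' j').2
    (lam_neq _ _ nii')).
have YZ k : dotcv (vecY n (zeta k)) (vecZ R n m) = 0.
  by rewrite dotcvZl dotcvZr dotcv_col_mx dotcv0l dotcv0r addr0 !mulr0.
have ZX s p : p \in T -> dotcv (vecZ R n m) (X s p) = 0.
  move=> /T_lt lt_p; rewrite dotcvZl dotcvZr dotcv_col_mx dotcv0l addr0 -/z.
  rewrite dotcvZr.
  (* As [B^T z = 0], the sign vector [z] is an eigenvector of the graph for [- r], while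
     [lam (tag p) > - r]. *)
  rewrite (@eigenvector_orthogonal _ _ _ (- r%:R) (lam (tag p)) z _ A_tr) ?mulr0 //.
  - by apply/(eigenvector_opp_degree e_simple e_regular ed_edges).
  - exact: (x_eigen _ _).2.
  by rewrite lt_eqF // -subr_gt0 opprK lam_gt.
set bas := (X in basis_of _ X).
have bas_eig b : b \in bas -> b != 0 /\ exists2 nu, Qadjmx R ed *m b = nu *: b &
    [\/ nu = -2, nu = 0 |
        exists (i : 'I_d.+1) (s : bool), (i < d)%N /\ nu = Qeig r (lam i) s].
  rewrite /bas !X_list mem_cat inE mem_cat.
  have XP s : b \in map (X s) T -> b != 0 /\
      exists2 nu, Qadjmx R ed *m b = nu *: b &
        exists (i : 'I_d.+1) (s : bool), (i < d)%N /\ nu = Qeig r (lam i) s.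
    case/mapP=> p /T_lt lt_p ->; have [? ?] := X_eig _ (tagged p) s lt_p.
    by split=> //; exists (Qeig r (lam (tag p)) s) => //; exists (tag p), s.
  case/or4P=> [/mapP[k _ ->]|/eqP->|/XP|/XP].
  - by have [? ?] := Y_eig k; split=> //; exists (-2) => //; constructor 1.
  - by have [? ?] := Z_eig; split=> //; exists 0 => //; constructor 2.
  - by case=> ? [nu ? ?]; split=> //; exists nu => //; constructor 3.
  - by case=> ? [nu ? ?]; split=> //; exists nu => //; constructor 3.
have bas_basis : basis_of fullv bas.
  rewrite basisEfree subvf dimvf /dim /= muln1.
  apply/andP; split; last first.
    have -> : size bas = (m - n + 1 + (size T + size T).+1)%N.
      by rewrite /bas !X_list size_cat size_map size_enum_ord /= size_cat !size_map.
    (* Only [n + m <= size bas] is required, and truncation in [m - n] can only raise the size. *)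
    by rewrite size_T; lia.
  apply: dotcv_orthogonal_free; first by apply/negP=> /bas_eig[]; rewrite eqxx.
  have T_uniq : uniq T.
    by apply: allpairs_uniq_dep => [|i _|[i j] [i' j'] _ _ //]; apply: enum_uniq.
  have X_orth s : pairwise (fun u v => dotcv u v == 0) (map (X s) T).
    apply: pairwise_map_uniq => // p q _ _ /x_orth x0; apply/eqP.
    exact: (vecX_orthogonal e_simple e_regular ed_edges _ _ _ (x_eigen _ _).2 x0).
  rewrite /bas !X_list pairwise_cat /= pairwise_cat !X_orth /= !andbT.
  (* Four cases remain: the [vecY] against all the others, the [vecY] among themselves, [vecZ]
     against the [vecX], and the [vecX] of sign + against those of sign -. *)
  apply/and4P; split.
  - apply/allrelP=> _ b /mapP[k _ ->]; rewrite inE mem_cat.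
    case/or3P=> [/eqP->|/mapP[p _ ->]|/mapP[p _ ->]]; first by rewrite YZ.
      by rewrite dotcv_vecY_vecX.
    by rewrite dotcv_vecY_vecX.
  - apply: pairwise_map_uniq => [|k l _ _ nkl]; first exact: enum_uniq.
    rewrite dotcvZl dotcvZr dotcv_col_mx dotcv0l zeta_orthonormal (negPf nkl).
    by rewrite addr0 !mulr0.
  - by apply/allP=> b; rewrite mem_cat => /orP[]/mapP[p Tp ->]; rewrite ZX.
  apply/allrelP=> _ _ /mapP[p _ ->] /mapP[q _ ->]; apply/eqP.
  (* For equal indices orthogonality comes from [coef_opp]; for distinct ones, from that of the
     graph's eigenvectors. *)
  have [<-|/x_orth x0] := eqVneq p q.
    exact: (vecX_conjugate_orthogonal e_simple e_regular ed_edges _ (x_eigen _ _).2).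
  exact: (vecX_orthogonal e_simple e_regular ed_edges _ _ _ (x_eigen _ _).2 x0).
split=> // mu; split=> [|muP].
  case/(eigenvalue_eigenbasis Q_tr bas_basis) => [b /bas_eig[_ [nu Qb _]]|b bb Qb].
    by exists nu.
  have [b0 [nu Qb' nuP]] := bas_eig b bb.
  suff -> : mu = nu by [].
  apply/eqP; rewrite -subr_eq0; have /eqP : (mu - nu) *: b = 0.
    by rewrite scalerBl -Qb -Qb' subrr.
  by rewrite scaler_eq0 (negPf b0) orbF.
suff [v] : exists v, eigenvector (Qadjmx R ed) mu v by apply: eigenvector_eigenvalue.
(* Witnesses exist because [m - n + 1] and every [a i] are positive, so each family has a first
   member. *)
case: muP => [->|->|[i [s [lt_id ->]]]].
- have k_lt : (0 < m - n + 1)%N by rewrite addn1.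
  by exists (vecY n (zeta (Ordinal k_lt))).
- by exists (vecZ R n m).
by exists (vecX ed r (lam i) s (x i (Ordinal (a_gt0 i)))); apply: X_eig.
Qed.
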